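(* For a graph $G$, $\operatorname{th}_+(G)=3$ if and only if at least one of the following holds: (1) $G$ is disconnected and either (a) $G$ is $3K_1$, or (b) $G$ has exactly two connected components, each component is a $K_1$ or a star $K_{1,m}$ for some $m\ge 1$ (depending on the component), and at least one component has order greater than one. (2) $G$ is a tree with diameter three or four. (3) $G$ is connected and there exist distinct vertices $v,u\in V(G)$ such that: (a) $G$ has a cycle, or $G$ is a tree with diameter $5$; (b) every vertex of $V(G)\setminus\{u,v\}$ belongs to $N(u)\cup N(v)$; (c) $\deg(w)\le 2$ for all $w\in V(G)\setminus\{v,u\}$; and (d) if $w_1,w_2\in V(G)\setminus\{u,v\}$ and either $w_1,w_2\in N(u)$ or $w_1,w_2\in N(v)$, then $w_1$ is not adjacent to $w_2$.
   Context: All graphs are finite, simple and undirected. $N(x)$ is the (open) neighborhood of $x$; $3K_1$ is the graph consisting of three isolated vertices. Positive semidefinite (PSD) color change rule: each vertex of $G$ is blue or white; let $B$ be the current set of blue vertices and let $W_1,\dots,W_k$ be the vertex sets of the connected components of $G-B$. A white vertex $w\in W_i$ is colored blue (is forced by the blue vertex $v$) when $w$ is the only white neighbor of $v$ in the induced subgraph $G[W_i\cup B]$. Starting with exactly the vertices of $S\subseteq V(G)$ blue, at each time step all possible forces are performed simultaneously. $S$ is a PSD zero forcing set if eventually all vertices become blue; in that case $\operatorname{pt}_+(G;S)$ is the number of time steps needed to color all vertices blue (so it is $0$ if $S=V(G)$), and otherwise $\operatorname{pt}_+(G;S)=\infty$. Define $\operatorname{th}_+(G;S)=|S|+\operatorname{pt}_+(G;S)$,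 and the PSD throttling number $\operatorname{th}_+(G)=\min\{\operatorname{th}_+(G;S): S \text{ is a PSD zero forcing set of } G\}$. *)

(* Defs.v *)
From mathcomp Require Import all_boot.

Set Implicit Arguments.
Unset Strict Implicit.
Unset Printing Implicit Defensive.

(* A graph is a finType of vertices with an edge relation; symmetry and
   irreflexivity of that relation are hypotheses of the theorem. *)

Definition graph_iso (T T' : finType) (e : rel T) (e' : rel T') : Prop :=
  exists2 f : T -> T', bijective f & forall x y, e' (f x) (f y) = e x y.

Definition edgeless (T : finType) : rel T := fun _ _ => false.

(* K_{1,m}: the centre is None, the leaves are the Some i. *)
Definition star (m : nat) : rel (option 'I_m) :=
  fun x y => (x == None) (+) (y == None).
Arguments star m : clear implicits.

Section Graphs.
Variables (T : finType) (e : rel T).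

Definition nbh (x : T) : {set T} := [set y | e x y].

Definition deg (x : T) : nat := #|nbh x|.

Definition induced (A : {set T}) : rel {x : T | x \in A} :=
  fun x y => e (val x) (val y).

(* The vertex sets of the connected components of G[A]. *)
Definition components (A : {set T}) : {set {set T}} :=
  equivalence_partition (connect [rel x y in A | e x y]) A.

Definition connected_graph : bool := #|components [set: T]| == 1.

Definition has_cycle : Prop := exists c : seq T, ucycle e c /\ 2 < size c.

Definition is_tree : Prop := connected_graph /\ ~ has_cycle.

Definition walk (x y : T) (n : nat) : bool :=
  [exists p : n.-tuple T, path e x p && (last x p == y)].

Lemma connect_walkP (x y : T) : reflect (exists n, walk x y n) (connect e x y).
Proof.
apply: (iffP connectP) => [[p ep ->]|[n /existsP[p /andP[ep /eqP<-]]]].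
  by exists (size p); apply/existsP; exists (in_tuple p); rewrite ep eqxx.
by exists p.
Qed.

(* Distances between vertices in the same component are < #|T|, so the value
   #|T| marks unreachable pairs. *)
Definition dist (x y : T) : nat :=
  if connect_walkP x y is ReflectT h then ex_minn h else #|T|.

(* Meaningful for connected graphs only. *)
Definition diameter : nat := \max_(x : T) \max_(y : T) dist x y.

(* v forces w when B is the set of blue vertices. *)
Definition psd_forces (B : {set T}) (v w : T) : bool :=
  (v \in B) &&
  [exists W in components (~: B),
     (w \in W) && ([set x in W :|: B | (x \notin B) && e v x] == [set w])].

Definition psd_step (B : {set T}) : {set T} :=
  B :|: [set w | [exists v, psd_forces B v w]].

Definition psd_all_blue (S : {set T}) (t : nat) : bool :=
  iter t psd_step S == [set: T].

Definition psd_zero_forcing (S : {set T}) : Prop := exists t, psd_all_blue S t.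

Lemma psd_zero_forcingP (S : {set T}) :
  reflect (psd_zero_forcing S) (psd_all_blue S #|T|).
Proof.
apply: (iffP idP) => [h|[t /eqP ht]]; first by exists #|T|.
have mono n k : iter n psd_step S \subset iter (k + n) psd_step S.
  elim: k => [|k IH] //=; apply: subset_trans IH _; exact: subsetUl.
have grow n : n <= #|iter n psd_step S|
    \/ psd_step (iter n psd_step S) = iter n psd_step S.
  elim: n => [|n [IH|IH]]; [by left| |by right; rewrite /= !IH].
  have /= := mono n 1; rewrite subEproper => /orP[/eqP E|/proper_card lt].
    by right; rewrite -E -E.
  by left; apply: leq_ltn_trans IH _.
apply/eqP; case: (grow #|T|) => [le|fixE].
  by apply/eqP; rewrite eqEcard subsetT cardsT.
have [le|/ltnW le] := leqP t #|T|.
  by apply/eqP; rewrite -subTset -ht -(subnK le) mono.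
rewrite -ht -(subnK le) iterD; elim: (t - #|T|) => //= k <-.
by rewrite fixE.
Qed.

(* None stands for infinity. *)
Definition psd_pt (S : {set T}) : option nat :=
  if psd_zero_forcingP S is ReflectT h then Some (ex_minn h) else None.

Definition psd_th_set (S : {set T}) : option nat :=
  omap (addn #|S|) (psd_pt S).

Lemma psd_th_ex : exists k, [exists S : {set T}, psd_th_set S == Some k].
Proof.
rewrite /psd_th_set /psd_pt.
have h : psd_zero_forcing [set: T] by exists 0; rewrite /psd_all_blue /=.
suff [k hk] : exists k, omap (addn #|[set: T]|)
    (if psd_zero_forcingP [set: T] is ReflectT h0 then Some (ex_minn h0)
     else None) = Some k.
  by exists k; apply/existsP; exists [set: T]; rewrite hk.
by case: psd_zero_forcingP => // h'; exists (#|[set: T]| + ex_minn h').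
Qed.

Definition psd_throttling : nat := ex_minn psd_th_ex.

End Graphs.

(* Main.v *)
Require Import Defs.
From mathcomp Require Import all_boot.

(** A set S has cost |S| plus its propagation time, so cost at most 3 on a graph
    with more than two vertices means one of three things: three vertices all
    blue from the start, one blue vertex finishing within two steps, or two blue
    vertices finishing within one step; and cost at most 2 means one blue vertex
    finishing within one step ([throttling_le2P], [throttling_le3P]).

    One blue vertex. In a forest every blue vertex forces each of its white
    neighbours, since two of them in the same white component would close a cycle
    ([acyclic_forces]); the blue set therefore spreads as a ball. Conversely,
    when a single vertex is blue at the start, every white component stays
    attached to only one blue vertex ([anchored_step]), and on a cycle the last
    vertex to become blue contradicts this ([single_acyclic]). Hence a single
    vertex c finishes within t steps exactly when the graph is a tree of radius
    at most t around c. A tree has a vertex of eccentricity at most half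
    the diameter, rounded up ([tree_center]), so such a c exists exactly when the
    graph is a tree of diameter at most 2t ([single_treeP]). The case t = 1 gives
    the graphs of throttling number at most 2, and t = 2 adds the trees of
    diameter three and four.

    Two blue vertices, one step. The white components then have at most two
    vertices, which is what the local conditions of [two_rooted] express
    ([two_rootedP]). On a disconnected graph these conditions say that there are
    two components, both stars ([two_rooted_disconnected]). On a connected graph
    they bound the diameter by 5 ([two_rooted_diameter]), so what is not yet
    covered by the trees of diameter at most four either has a cycle or is a tree
    of diameter 5.

    Three blue vertices. If the three-vertex graph has an edge, one end of the
    edge can be left white and is forced in one step ([edge_on_three]); only the
    edgeless graph is new. *)

Section PsdThrottling.
Set Implicit Arguments.
Unset Strict Implicit.
Unset Printing Implicit Defensive.

Variables (T : finType) (e : rel T).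
Hypotheses (e_sym : symmetric e) (e_irr : irreflexive e).

(** * Walks and connectivity *)

Lemma connect_ind (r : rel T) (P : pred T) x y :
  (forall a b, r a b -> P a -> P b) -> connect r x y -> P x -> P y.
Proof.
move=> rP /connectP[p]; elim: p x => [|z p IH] x /=; first by move=> _ ->.
by case/andP=> xz zp yE Px; apply: IH zp yE (rP _ _ xz Px).
Qed.

Lemma walk0 x y : walk e x y 0 = (x == y).
Proof.
apply/existsP/idP => [[p]|xy]; last by exists [tuple].
by rewrite tuple0 /=.
Qed.

Lemma walkSP x y n :
  reflect (exists2 z, e x z & walk e z y n) (walk e x y n.+1).
Proof.
apply: (iffP existsP) => [[p]|[z xz /existsP[p zp]]].
  case/tupleP: p => z p /=; rewrite -andbA => /andP[xz zp].
  by exists z => //; apply/existsP; exists p.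
by exists [tuple of z :: p]; rewrite /= xz.
Qed.

Lemma walk_cat x y z m n :
  walk e x y m -> walk e y z n -> walk e x z (m + n).
Proof.
elim: m x => [|m IH] x; first by rewrite walk0 => /eqP->.
by case/walkSP=> t xt ty yz; rewrite addSn; apply/walkSP; exists t => //; apply: IH.
Qed.

Lemma walk_edge x y : e x y -> walk e x y 1.
Proof. by move=> xy; apply/walkSP; exists y; rewrite ?walk0. Qed.

Lemma walk_sym x y n : walk e x y n -> walk e y x n.
Proof.
elim: n x => [|n IH] x; first by rewrite !walk0 eq_sym.
case/walkSP=> z xz /IH yz; rewrite -addn1; apply: walk_cat yz _.
by apply: walk_edge; rewrite e_sym.
Qed.

Lemma dist_le_walk x y n : walk e x y n -> dist e x y <= n.
Proof.
rewrite /dist => xy; case: connect_walkP => [h|[]]; last by exists n.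
by case: ex_minnP => m _ ->.
Qed.

Lemma walk_dist x y : connect e x y -> walk e x y (dist e x y).
Proof.
rewrite /dist => xy; case: connect_walkP => [h|/connect_walkP]; last by rewrite xy.
by case: ex_minnP.
Qed.

Lemma walk_connect x y n : walk e x y n -> connect e x y.
Proof. by move=> xy; apply/connect_walkP; exists n. Qed.

Lemma dist_lt_card x y : connect e x y -> dist e x y < #|T|.
Proof.
case/connectP=> p ep ->; case: (shortenP ep) => p' ep' Up' _.
have le : (size p').+1 <= #|T| by rewrite (_ : _.+1 = #|x :: p'|) ?max_card ?(card_uniqP Up').
apply: leq_ltn_trans le; apply: dist_le_walk.
by apply/existsP; exists (in_tuple p'); rewrite ep' eqxx.
Qed.

Lemma connectedP :
  reflect (0 < #|T| /\ forall x y, connect e x y) (connected_graph e).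
Proof.
have E : connect [rel x y in [set: T] | e x y] =2 connect e.
  by apply: eq_connect => x y; rewrite /= !inE.
rewrite /connected_graph /components.
apply: (iffP idP) => [/cards1P[C CE]|[/card_gt0P[x _] cxy]].
  have in_C x : [set y in [set: T] | connect [rel x y in [set: T] | e x y] x y] = C.
    by apply/set1P; rewrite -CE; apply/imsetP; exists x.
  split=> [|x y].
    have: C \in [set C] by rewrite set11.
    by rewrite -CE => /imsetP[x _ _]; apply/card_gt0P; exists x.
  have: y \in [set y in [set: T] | connect [rel x y in [set: T] | e x y] x y].
    by rewrite in_C -(in_C y) !inE connect0.
  by rewrite !inE E.
apply/cards1P; exists [set: T]; apply/setP=> C; rewrite inE.
have all_C z : [set y in [set: T] | connect [rel x y in [set: T] | e x y] z y] = setT.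
  by apply/setP=> y; rewrite !inE E cxy.
apply/imsetP/eqP=> [[z _ ->]|->]; first exact: all_C.
by exists x; rewrite ?all_C.
Qed.

Lemma componentsP (A C : {set T}) :
  reflect (exists2 x, x \in A
             & C = [set y in A | connect [rel x y in A | e x y] x y])
          (C \in components e A).
Proof. exact: imsetP. Qed.

Lemma components_setTP (C : {set T}) :
  reflect (exists x, C = [set y | connect e x y]) (C \in components e [set: T]).
Proof.
have E x : [set y in [set: T] | connect [rel x y in [set: T] | e x y] x y]
           = [set y | connect e x y].
  apply/setP=> y; rewrite !inE; apply: eq_connect => {}x {}y.
  by rewrite /= !inE.
apply: (iffP (componentsP _ _)) => [[x _ ->]|[x ->]]; exists x => //.
Qed.

(** * The colour change rule *)

Local Notation white B := [rel x y in ~: B | e x y].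

Lemma white_sym B : connect_sym (white B).
Proof. by apply: sym_connect_sym => x y; rewrite /= !inE e_sym [_ && (y \notin B)]andbC. Qed.

Lemma sub_white_connect (A B : {set T}) x y :
  A \subset B -> connect (white B) x y -> connect (white A) x y.
Proof.
move=> /subsetP AB; apply: connect_sub => a b /=; rewrite !inE -andbA.
case/and3P=> aB bB ab; apply: connect1; rewrite /= !inE ab andbT.
by rewrite (contra (AB _) aB) (contra (AB _) bB).
Qed.

(** The form of the rule used below: the white component of w is described by
    reachability from w through white vertices. *)
Lemma psd_forcesP (B : {set T}) v w :
  reflect [/\ v \in B, w \notin B, e v w &
           forall x, x \notin B -> e v x -> connect (white B) w x -> x = w]
          (psd_forces e B v w).
Proof.
apply: (iffP andP) => [[vB /existsP[W /and3P[/componentsP[z zB ->]]]]|[vB wB vw uw]].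
  rewrite !inE => /andP[wB zw] /eqP E.
  have: w \in [set w] by rewrite set11.
  rewrite -E !inE (negPf wB) => /andP[_ vw]; split=> // x xB vx wx.
  apply/set1P; rewrite -E !inE (negPf xB) vx /= orbF andbT.
  exact: connect_trans zw wx.
split=> //; apply/existsP.
exists [set y in ~: B | connect (white B) w y]; apply/and3P; split.
- by apply/componentsP; exists w; rewrite // inE.
- by rewrite !inE wB connect0.
apply/eqP/setP=> x; rewrite !inE; apply/idP/eqP=> [|->].
  case/andP=> /orP[/andP[xB wx]|xB] /andP[xB' vx]; first exact: uw.
  by rewrite xB in xB'.
by rewrite wB connect0 vw.
Qed.

Lemma psd_stepP (B : {set T}) w :
  reflect (w \in B \/ exists v, psd_forces e B v w) (w \in psd_step e B).
Proof.
rewrite !inE; apply: (iffP orP) => -[wB|]; [by left| |by left|].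
- by move/existsP; right.
- by move=> h; right; apply/existsP.
Qed.

Lemma psd_step_sub (B : {set T}) : B \subset psd_step e B.
Proof. exact: subsetUl. Qed.

Lemma psd_all_blueS (S : {set T}) t :
  psd_all_blue e S t -> psd_all_blue e S t.+1.
Proof. by rewrite /psd_all_blue -!subTset => h; apply: subset_trans h (psd_step_sub _). Qed.

Lemma psd_all_blue_le (S : {set T}) s t :
  s <= t -> psd_all_blue e S s -> psd_all_blue e S t.
Proof. by move=> /subnK<-; elim: (t - s) => // k IH /IH /psd_all_blueS. Qed.

(** Unused time is harmless, so a budget k can be spent entirely: k - |S| steps
    for the starting set S. *)
Lemma throttling_leP k :
  reflect (exists2 S : {set T}, #|S| <= k & psd_all_blue e S (k - #|S|))
          (psd_throttling e <= k).
Proof.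
rewrite /psd_throttling; case: ex_minnP => m ex_m m_min.
apply: (iffP idP) => [mk|[S' S'k blue]].
  case/existsP: ex_m => S /eqP; rewrite /psd_th_set /psd_pt.
  case: psd_zero_forcingP => //= h; case: ex_minnP => n blue _ [mE].
  rewrite -mE in mk; exists S; first exact: leq_trans (leq_addr _ _) mk.
  by apply: psd_all_blue_le blue; rewrite leq_subRL // (leq_trans (leq_addr _ _) mk).
have h : psd_zero_forcing e S' by exists (k - #|S'|).
rewrite -(subnKC S'k).
have [n nk /eqP En] : exists2 n, n <= k - #|S'| & psd_th_set e S' == Some (#|S'| + n).
  rewrite /psd_th_set /psd_pt; case: psd_zero_forcingP => // h'.
  by exists (ex_minn h') => //; case: ex_minnP => n _; apply.
apply: leq_trans (m_min (#|S'| + n) _) _; first by apply/existsP; exists S'; rewrite En.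
by rewrite leq_add2l.
Qed.

Lemma psd_all_blue1 (S : {set T}) :
  psd_all_blue e S 1 <-> forall w, w \notin S -> exists v, psd_forces e S v w.
Proof.
rewrite /psd_all_blue /= -subTset; split=> [/subsetP h w wS|h].
  have /psd_stepP[wS'|//] := h w (in_setT _); by rewrite wS' in wS.
apply/subsetP=> w _; apply/psd_stepP; case: (boolP (w \in S)) => [|/h]; by [left|right].
Qed.

Lemma psd_all_blue0 (S : {set T}) : psd_all_blue e S 0 = (S == setT).
Proof. by []. Qed.

(** Colour spreads along edges only, so it travels at most one edge per step. *)
Lemma blue_walk (S : {set T}) t x :
  x \in iter t (psd_step e) S -> exists2 s, s \in S & exists2 n, n <= t & walk e s x n.
Proof.
elim: t x => [|t IH] x /=; first by move=> xS; exists x => //; exists 0; rewrite ?walk0.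
case/psd_stepP=> [/IH[s sS [n nt sx]]|[v /psd_forcesP[/IH[s sS [n nt sv]] _ vx _]]].
  by exists s => //; exists n => //; apply: leqW.
exists s => //; exists n.+1 => //; rewrite -addn1; apply: walk_cat sv _.
exact: walk_edge.
Qed.

(** * One blue vertex: trees *)

(** Otherwise the path from w, closed up through v, would be a cycle. *)
Lemma acyclic_edge_path v w p :
  ~ has_cycle e -> e v w -> path e w p -> uniq (w :: p) -> v \notin w :: p ->
  e v (last w p) -> last w p = w.
Proof.
case/lastP: p => // p z acyc vw wp Up vp; rewrite last_rcons => vz; case: acyc.
exists (v :: w :: rcons p z); split; last by rewrite /= size_rcons.
apply/andP; split; last by rewrite cons_uniq vp.
by rewrite /= vw rcons_path wp last_rcons e_sym.
Qed.

(** If v had a second neighbour in the white component of w, then a white path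
    between the two neighbours would close up through v. *)
Lemma acyclic_forces (B : {set T}) v w :
  ~ has_cycle e -> v \in B -> w \notin B -> e v w -> psd_forces e B v w.
Proof.
move=> acyc vB wB vw; apply/psd_forcesP; split=> // x xB vx.
case/connectP=> p ep xE; move: vx; rewrite xE {x xB xE}.
case: (shortenP ep) => {ep}p ep Up _ vx.
apply: (acyclic_edge_path (v := v) acyc) => //.
  by apply: sub_path ep => a b /andP[].
have: all (fun y => y \notin B) (w :: p).
  elim: p w wB {vw vx Up} ep => [|z p IH] w wB /=; first by rewrite wB.
  case/andP=> /andP[/andP[_ zB] _] /IH IHp; rewrite wB /=; apply: IHp.
  by rewrite !inE in zB.
by move=> allW; apply/negP=> /(allP allW); rewrite vB.
Qed.

(** Since every edge leaving the blue set is a force, the blue set of a forest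
    grows by whole neighbourhoods. *)
Lemma acyclic_blue (S : {set T}) s x n t :
  ~ has_cycle e -> s \in S -> walk e s x n -> n <= t ->
  x \in iter t (psd_step e) S.
Proof.
move=> acyc sS sx nt.
have mono k : k <= t -> iter k (psd_step e) S \subset iter t (psd_step e) S.
  move=> /subnK<-; elim: (t - k) => //= j IH; apply: subset_trans IH (psd_step_sub _).
apply: (subsetP (mono _ nt)); elim: n x sx {nt} => [|n IH] x.
  by rewrite walk0 => /eqP<-.
move/walk_sym/walkSP=> [z xz /walk_sym/IH zB] /=.
apply/psd_stepP; case: (boolP (x \in iter n (psd_step e) S)); first by left.
by move=> xB; right; exists z; apply: acyclic_forces; rewrite // e_sym.
Qed.

(** Every component of the white graph has at most one blue neighbour, its
    anchor, although possibly through several edges. *)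
Definition anchored (B : {set T}) : Prop :=
  forall x y a b, x \notin B -> y \notin B -> connect (white B) x y ->
    a \in B -> b \in B -> e a x -> e b y -> a = b.

Lemma anchored_same_force (B : {set T}) v v' w w' :
  anchored B -> psd_forces e B v w -> psd_forces e B v' w' ->
  connect (white B) w w' -> w = w'.
Proof.
move=> anc /psd_forcesP[vB wB vw uw] /psd_forcesP[v'B w'B v'w' _] ww'.
have vv' : v = v' by apply: anc ww' _ _ vw v'w'.
by rewrite [w'](uw w') // vv'.
Qed.

Lemma white_edge (B : {set T}) x y :
  x \notin B -> y \notin B -> e x y -> connect (white B) x y.
Proof. by move=> xB yB xy; apply: connect1; rewrite /= !inE xB yB. Qed.

(** A white component W with anchor v changes only if v has a unique neighbour w
    in W; the components of W - w then touch no blue vertex other than w. *)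
Lemma anchored_step (B : {set T}) : anchored B -> anchored (psd_step e B).
Proof.
move=> anc x y a b xB' yB' xy aB' bB' ax by_.
have /subsetP sub := psd_step_sub B.
have xB : x \notin B := contra (sub x) xB'.
have yB : y \notin B := contra (sub y) yB'.
have {}xy := sub_white_connect (psd_step_sub B) xy.
(* A vertex forced in this step is its anchor's only neighbour in its white
   component, so the anchor keeps no neighbour among the still white ones. *)
have no_old c z c' z' : z \notin psd_step e B -> z' \notin psd_step e B ->
    connect (white B) z z' -> c \notin B -> c \in psd_step e B -> e c z ->
    e c' z' -> c' \in B -> False.
  move=> zB' z'B' zz' cB cB' cz c'z' c'B.
  have zB : z \notin B := contra (sub z) zB'.
  have z'B : z' \notin B := contra (sub z') z'B'.
  case/psd_stepP: cB' => [cB1|[v /psd_forcesP[vB _ vc uc]]]; first by rewrite cB1 in cB.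
  have cz' : connect (white B) c z' by apply: connect_trans (white_edge cB zB cz) zz'.
  have E : v = c' by apply: anc cz' _ _ vc c'z'.
  have z'c : z' = c by apply: uc; rewrite // E.
  by case/negP: z'B'; rewrite z'c; apply/psd_stepP; right; exists v; apply/psd_forcesP.
case: (boolP (a \in B)) => aB; case: (boolP (b \in B)) => bB.
- exact: anc xy _ _ ax by_.
- by case: (no_old b y a x) => //; rewrite white_sym.
- by case: (no_old a x b y).
case/psd_stepP: aB' => [aB1|[v va]]; first by rewrite aB1 in aB.
case/psd_stepP: bB' => [bB1|[v' vb]]; first by rewrite bB1 in bB.
apply: anchored_same_force anc va vb _.
apply: connect_trans (white_edge aB xB ax) (connect_trans xy _).
by apply: white_edge; rewrite // e_sym.
Qed.

(** A vertex z of the cycle coloured last would have two different blue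
    neighbours while still white, or be forced at the same time as a neighbour
    in its own white component; the anchor of that component excludes both. *)
Lemma single_acyclic c t : psd_all_blue e [set c] t -> ~ has_cycle e.
Proof.
move=> /eqP blue [C [ucC sizeC]].
have anc s : anchored (iter s (psd_step e) [set c]).
  elim: s => [|s IH]; last exact: anchored_step.
  by move=> x y a b _ _ _ /set1P-> /set1P->.
have: exists s, all (fun x => x \in iter s (psd_step e) [set c]) C.
  by exists t; rewrite blue; apply/allP=> x; rewrite inE.
case/ex_minnP=> s allC s_min.
case: s allC s_min => [|s] allC s_min.
  case/andP: ucC => _; case: C allC sizeC {s_min} => [|x [|y C]] //=.
  by rewrite !inE => /and3P[/eqP-> /eqP-> _]; rewrite eqxx.
have [z zC zB] : exists2 z, z \in C & z \notin iter s (psd_step e) [set c].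
  by apply/allPn/negP=> /s_min; rewrite ltnn.
(* The time s.+1 is the first at which the whole cycle is blue, so the cycle
   neighbours x and y of z are coloured no later than z. *)
have [x [y [xy zx zy /allP xyC]]] :
    exists x y, [/\ x != y, e z x, e z y & all (mem C) [:: z; x; y]].
  case: (rot_to zC) => i C' rC; have: ucycle e (rot i C) by rewrite rot_ucycle.
  rewrite rC.
  case/andP=> [cyc U].
  have: size (z :: C') = size C by rewrite -rC size_rot.
  case: C' rC cyc U => [|x C'] rC cyc U szC; first by rewrite -szC in sizeC.
  case/lastP: C' rC cyc U szC => [|C' y] rC cyc U szC; first by rewrite -szC in sizeC.
  exists x, y; move: cyc U; rewrite /= rcons_path last_rcons mem_rcons inE negb_or.
  case/and3P=> zx _ yz /and3P[_ /andP[xy _] _]; split=> //; first by rewrite e_sym.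
  by rewrite -!(mem_rot i C) rC !(inE, mem_rcons) !eqxx !orbT.
have blueC p : p \in C -> p \in psd_step e (iter s (psd_step e) [set c]) by move/(allP allC).
have [v vz] : exists v, psd_forces e (iter s (psd_step e) [set c]) v z.
  by case/psd_stepP: (blueC z zC) => // zB'; rewrite zB' in zB.
have nb_old p : e z p -> p \in C -> p \in iter s (psd_step e) [set c].
  move=> zp pC; apply: contraT => pB.
  case/psd_stepP: (blueC p pC) => [pB'|[v' v'p]]; first by rewrite pB' in pB.
  have E : z = p by apply: anchored_same_force (anc s) vz v'p (white_edge zB pB zp).
  by rewrite E e_irr in zp.
case/eqP: xy; apply: (anc s z z) => //; rewrite 1?[e _ z]e_sym //;
  by apply: nb_old => //; apply: xyC; rewrite !inE eqxx ?orbT.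
Qed.

Lemma single_psdP c t :
  psd_all_blue e [set c] t <->
  is_tree e /\ forall x, dist e c x <= t.
Proof.
split=> [blue|[[/connectedP[_ con] acyc] rad]]; last first.
  rewrite /psd_all_blue -subTset; apply/subsetP=> x _.
  by apply: acyclic_blue acyc (set11 c) (walk_dist (con c x)) (rad x).
have cw x : exists2 n, n <= t & walk e c x n.
  have: x \in iter t (psd_step e) [set c] by rewrite (eqP blue).
  by case/blue_walk=> s /set1P->.
split; last by move=> x; case: (cw x) => n nt /dist_le_walk/leq_trans->.
split; last exact: single_acyclic blue.
apply/connectedP; split; first by apply/card_gt0P; exists c.
have cc x : connect e c x by case: (cw x) => n _ /walk_connect.
by move=> x y; apply: connect_trans (cc y); rewrite (sym_connect_sym e_sym).
Qed.

(** * Radius and diameter of a tree *)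

Lemma dist_diameter x y : dist e x y <= diameter e.
Proof. exact: leq_trans (leq_bigmax y) (leq_bigmax (F := fun x => \max_y dist e x y) x). Qed.

Lemma diameter_le k : (forall x y, dist e x y <= k) -> diameter e <= k.
Proof. by move=> dk; apply/bigmax_leqP=> x _; apply/bigmax_leqP=> y _. Qed.

Local Notation cut c c' := [rel a b | e a b && ([set a; b] != [set c; c'])].

Lemma acyclic_bridge c c' :
  ~ has_cycle e -> e c c' -> ~~ connect (cut c c') c' c.
Proof.
move=> acyc cc'; apply/negP=> /connectP[p ep cE].
case: (shortenP ep) cE => {ep} p ep Up _ cE; apply: acyc.
exists (c' :: p); split.
  apply/andP; split=> //; rewrite /= rcons_path -cE cc' andbT.
  by apply: sub_path ep => a b /andP[].
case: p ep Up cE => [|a [|b p]] //= ep Up cE.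
  by rewrite cE e_irr in cc'.
by case/andP: ep => /andP[_ /negP[]]; rewrite cE setUC.
Qed.

(** The edge between c and c' is the only passage between the two sides. *)
Lemma cut_walk c c' x y n :
  ~~ connect (cut c c') c' c -> connect (cut c c') c' x ->
  ~~ connect (cut c c') c' y -> walk e x y n ->
  exists n1 n2, [/\ n = n1 + n2.+1, walk e x c' n1 & walk e c y n2].
Proof.
move=> c'c; elim: n x => [|n IH] x c'x c'y.
  by rewrite walk0 => /eqP E; rewrite -E c'x in c'y.
case/walkSP=> z xz zy; case: (boolP (connect (cut c c') c' z)) => [c'z|c'z].
  have [n1 [n2 [-> zc' cy]]] := IH z c'z c'y zy.
  by exists n1.+1, n2; split=> //; apply/walkSP; exists z.
have xzE : [set x; z] = [set c; c'].
  apply/eqP; apply: contraR c'z => ne; apply: connect_trans c'x (connect1 _).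
  by rewrite /= xz.
have xc : x != c by apply: contraNneq c'c => E; rewrite -[X in connect _ _ X]E.
have xE : x = c'.
  by have := set21 x z; rewrite xzE !inE (negPf xc) => /eqP.
have zE : z = c.
  by have := set21 c c'; rewrite -xzE !inE eq_sym (negPf xc) => /eqP.
by exists 0, n; split; rewrite ?walk0 ?xE // -zE.
Qed.

(** Take c of least eccentricity r + 1, a vertex z at that distance, and the
    neighbour c' of c towards z. Moving to c' does not reduce the eccentricity,
    so some z' is at distance at least r + 1 from c'. It cannot lie on the side
    of z of the edge between c and c', as it would then be further than r + 1
    from c. A walk from z to z' therefore crosses this edge and has length at
    least r + 1 + r. *)
Lemma tree_center : is_tree e -> exists c, forall x, 2 * dist e c x <= (diameter e).+1.
Proof.
case=> /connectedP[T_gt0 con] acyc; have /card_gt0P[x0 _] := T_gt0.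
pose ecc c := \max_x dist e c x.
have dist_ecc c x : dist e c x <= ecc c by apply: leq_bigmax.
have ecc_att c : exists z, dist e c z = ecc c.
  by have [z zE] := eq_bigmax (dist e c) T_gt0; exists z; rewrite /ecc zE.
pose c := [arg min_(c < x0) ecc c].
have c_min c' : ecc c <= ecc c' by rewrite /c; case: arg_minnP => // i _; apply.
exists c => x; apply: leq_trans (leq_mul (leqnn 2) (dist_ecc c x)) _.
have [z dz] := ecc_att c; case E: (ecc c) dz => [|r] dz; first by rewrite muln0.
have := walk_dist (con c z); rewrite dz => /walkSP[c' cc' c'z].
have [z' dz'] := ecc_att c'; have := c_min c'; rewrite E -dz' => c'z'.
have br := acyclic_bridge acyc cc'.
have zA : connect (cut c c') c' z.
  apply: contraT => zA; have [n1 [n2 [rE _ cz]]] := cut_walk br (connect0 _ _) zA c'z.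
  by have := dist_le_walk cz; rewrite dz rE addnS ltnNge leqW ?leq_addl.
have z'A : ~~ connect (cut c c') c' z'.
  apply/negP=> z'A.
  have [n1 [n2 [nE z'c' _]]] := cut_walk br z'A br (walk_sym (walk_dist (con c z'))).
  have := dist_ecc c z'; rewrite E nE addnS ltnS => le.
  have := leq_trans c'z' (dist_le_walk (walk_sym z'c')).
  by rewrite ltnNge (leq_trans (leq_addr n2 _) le).
have [n1 [n2 [nE zc' cz']]] := cut_walk br zA z'A (walk_dist (con z z')).
have : r.+1 <= n1.+1.
  rewrite -dz; apply: dist_le_walk; apply: walk_sym.
  by rewrite -addn1; apply: walk_cat zc' (walk_edge _); rewrite e_sym.
have : r.+1 <= n2.+1.
  apply: leq_trans c'z' (dist_le_walk _); apply/walkSP.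
  by exists c; rewrite // e_sym.
move=> rn2 rn1; apply: (@leq_trans (dist e z z').+1); last by rewrite ltnS dist_diameter.
by rewrite nE mul2n -addnn -addSn leq_add.
Qed.

Lemma single_treeP t :
  (exists c, psd_all_blue e [set c] t) <-> is_tree e /\ diameter e <= 2 * t.
Proof.
split=> [[c /single_psdP[tree rad]]|[tree diam]].
  split=> //; apply: diameter_le => x y; case: tree => /connectedP[_ con] _.
  have xcy := walk_cat (walk_sym (walk_dist (con c x))) (walk_dist (con c y)).
  apply: leq_trans (dist_le_walk xcy) _.
  by rewrite mul2n -addnn leq_add.
have [c rad] := tree_center tree; exists c; apply/single_psdP; split=> // x.
have := leq_trans (rad x) (diam : _ < (2 * t).+1).
by rewrite !mul2n -leq_half_double doubleK.
Qed.

(** * Two blue vertices, one step *)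

(** The local form of finishing in one step from u and v: a white component is a
    single vertex, or an edge with one end attached to u and the other to v. *)
Definition two_rooted (u v : T) : Prop :=
  [/\ forall w, w \notin [set u; v] -> w \in nbh e u :|: nbh e v,
      forall w, w \notin [set u; v] -> deg e w <= 2
    & forall w1 w2, w1 \notin [set u; v] -> w2 \notin [set u; v] ->
        (w1 \in nbh e u /\ w2 \in nbh e u) \/
        (w1 \in nbh e v /\ w2 \in nbh e v) ->
        ~~ e w1 w2].

Lemma two_rootedC u v : two_rooted u v -> two_rooted v u.
Proof.
case=> dom deg2 indep; split=> [w|w|w1 w2]; rewrite [[set v; u]]setUC.
- by rewrite [nbh e v :|: _]setUC; apply: dom.
- exact: deg2.
by move=> w1S w2S h; apply: indep => //; case: h; [right|left].
Qed.

Lemma two_rooted_forces u v w :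
  two_rooted u v -> w \notin [set u; v] -> e u w -> psd_forces e [set u; v] u w.
Proof.
case=> dom deg2 indep wS uw; apply/psd_forcesP; split=> // [|x xS ux wx].
  exact: set21.
have nb y : y \notin [set u; v] -> e w y -> e v y.
  move=> yS wy; have := dom y yS; rewrite !inE => /orP[uy|//].
  by case/negP: (indep w y wS yS ltac:(by left; rewrite !inE)).
(* The white component of w is contained in the white closed neighbourhood
   of w: a white neighbour y has neighbours v and w, hence no others. *)
have: (x == w) || (x \notin [set u; v]) && e w x.
  pose P y := (y == w) || (y \notin [set u; v]) && e w y.
  apply: (connect_ind (P := P) _ wx); last by rewrite /P eqxx.
  rewrite /P => a b /= /andP[/andP[]]; rewrite ![_ \in ~: _]inE => aS bS ab.
  case/orP=> [/eqP<-|/andP[_ wa]]; first by rewrite bS ab orbT.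
  have va := nb a aS wa; apply/orP; left; apply: contraT => bw.
  have: #|[set v; w; b]| <= 2.
    apply: leq_trans (deg2 a aS); apply: subset_leq_card; apply/subsetP=> y.
    by rewrite !inE => /orP[/orP[]|] /eqP->; rewrite // e_sym.
  rewrite setUC cardsU1 cards2 !inE (negPf bw) orbF.
  have -> : b != v by apply: contraNneq bS => ->; rewrite set22.
  have -> : v != w by apply: contraNneq wS => <-; rewrite set22.
  by [].
case/orP=> [/eqP//|/andP[_ wx']].
by case/negP: (indep w x wS xS ltac:(by left; rewrite !inE)).
Qed.

Lemma two_rootedP u v : psd_all_blue e [set u; v] 1 <-> two_rooted u v.
Proof.
split=> [/psd_all_blue1 forced|tr]; last first.
  apply/psd_all_blue1=> w wS.
  case: (tr) => dom _ _; have := dom w wS; rewrite !inE => /orP[uw|vw].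
    by exists u; apply: two_rooted_forces.
  exists v; rewrite setUC; apply: two_rooted_forces => //; first exact: two_rootedC.
  by rewrite setUC.
(* Adjacent white vertices have different forcing vertices. *)
have once z w x : psd_forces e [set u; v] z w -> x \notin [set u; v] -> e w x ->
    ~~ e z x.
  case/psd_forcesP=> zS wS zw uw xS wx; apply/negP=> zx.
  have E := uw x xS zx (white_edge wS xS wx).
  by rewrite E e_irr in wx.
split=> [w wS|w wS|w1 w2 w1S w2S h].
- have [z /psd_forcesP[zS _ zw _]] := forced w wS.
  by rewrite !inE; case/set2P: zS => <-; rewrite zw ?orbT.
- have [z zw] := forced w wS.
  have nbr_white x : x \notin [set u; v] -> e w x ->
      exists2 z', z' \in [set u; v] :\ z & psd_forces e [set u; v] z' x.
    move=> xS wx; have [z' z'x] := forced x xS; exists z' => //.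
    case/psd_forcesP: (z'x) => z'S _ ex _; rewrite !inE in z'S *; rewrite z'S andbT.
    by apply: contraNneq (once z w x zw xS wx) => <-.
  have zS : z \in [set u; v] by case/psd_forcesP: zw.
  have [z' S'E] : exists z', [set u; v] :\ z \subset [set z'].
    case/set2P: zS => ->; [exists v|exists u]; apply/subsetP=> y; rewrite !inE.
      by case/andP=> /negPf->.
    by case/andP=> /negPf->; rewrite orbF.
  have card_le2 (a b : T) : nbh e w \subset [set a; b] -> deg e w <= 2.
    by move=> /subset_leq_card/leq_trans; apply; rewrite cards2; case: eqP.
  case: (pickP [pred x | (x \notin [set u; v]) && e w x]) => [x /andP[xS wx]|none].
    have [z1 z1S z1x] := nbr_white x xS wx.
    have z1E : z1 = z' by apply/set1P; apply: (subsetP S'E).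
    apply: (card_le2 z x); apply/subsetP=> y; rewrite !inE => wy.
    case: (boolP (y \in [set u; v])) => yS.
      apply/orP; left; apply: contraT => yz.
      have yE : y = z'.
        by apply/set1P; apply: (subsetP S'E); rewrite !inE yz; rewrite !inE in yS.
      have := once z1 x w z1x wS; rewrite e_sym => /(_ wx); by rewrite z1E -yE e_sym wy.
    have [z2 z2S z2y] := nbr_white y yS wy.
    have z2E : z2 = z' by apply/set1P; apply: (subsetP S'E).
    case/psd_forcesP: (z1x) => _ _ z1x' u1; case/psd_forcesP: (z2y) => _ _ z2y' _.
    apply/orP; right; apply/eqP; apply: u1 => //; first by rewrite z1E -z2E.
    by apply: connect_trans (white_edge wS yS wy); apply: white_edge; rewrite // e_sym.
  apply: (card_le2 u v); apply/subsetP=> y; rewrite inE => wy.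
  by apply: contraFT (none y) => yS; rewrite /= yS.
apply/negP=> w12; have [z1 f1] := forced w1 w1S; have [z2 f2] := forced w2 w2S.
have n1 := once _ _ _ f1 w2S w12.
have w21 : e w2 w1 by rewrite e_sym.
have n2 := once _ _ _ f2 w1S w21.
case/psd_forcesP: f1 => z1S _ e1 _; case/psd_forcesP: f2 => z2S _ e2 _.
move: h; rewrite !inE => h.
case/set2P: z1S n1 e1 => -> n1 e1; case/set2P: z2S n2 e2 => -> n2 e2;
  case: h => -[h1 h2]; by rewrite ?h1 ?h2 ?e1 ?e2 in n1 n2.
Qed.

(** A path from u to v leaves the closed neighbourhood of u through an edge into
    that of v, so u and v are at distance at most 3. *)
Lemma two_rooted_diameter u v :
  connected_graph e -> two_rooted u v -> diameter e <= 5.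
Proof.
case/connectedP=> _ con [dom _ _].
have tri x y z : dist e x z <= dist e x y + dist e y z.
  by apply: dist_le_walk; apply: walk_cat (walk_dist (con x y)) (walk_dist (con y z)).
have dC x y : dist e x y = dist e y x.
  by apply/eqP; rewrite eqn_leq !dist_le_walk // walk_sym // walk_dist.
have d0 x : dist e x x <= 0 by apply: dist_le_walk; rewrite walk0.
have d1 x y : e x y -> dist e x y <= 1 by move=> xy; apply: dist_le_walk; apply: walk_edge.
have near x : (dist e u x <= 1) || (dist e v x <= 1).
  case: (boolP (x \in [set u; v])) => [/set2P[]->|/dom]; rewrite ?(leq_trans (d0 _)) ?orbT //.
  by rewrite !inE => /orP[] /d1->; rewrite ?orbT.
have uv3 : dist e u v <= 3.
  case: (boolP [exists a, exists b, [&& e a b, dist e u a <= 1 & dist e v b <= 1]]).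
    case/existsP=> a /existsP[b /and3P[ab ua vb]].
    apply: leq_trans (tri u a v) _; apply: (@leq_add _ _ 1 2) => //.
    apply: leq_trans (tri a b v) _; apply: (@leq_add _ _ 1 1); first exact: d1.
    by rewrite dC.
  rewrite negb_exists => /forallP none.
  suff: dist e u v <= 1 by move/leq_trans; apply.
  apply: (connect_ind (P := fun x => dist e u x <= 1) _ (con u v)); last first.
    exact: leq_trans (d0 u) _.
  move=> a b ab ua; case/orP: (near b) => // vb.
  by have := none a; rewrite negb_exists => /forallP/(_ b); rewrite ab ua vb.
have near2 x s t : dist e s x <= 1 -> dist e s t <= 3 -> dist e t x <= 4.
  by move=> sx st; apply: leq_trans (tri t s x) _; rewrite dC (@leq_add _ _ 3 1).
have uu : dist e u u <= 3 := leq_trans (d0 u) isT.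
have vv : dist e v v <= 3 := leq_trans (d0 v) isT.
apply: diameter_le => x y.
have via s : dist e s x <= 1 -> dist e s y <= 4 -> dist e x y <= 5.
  by move=> sx sy; apply: leq_trans (tri x s y) _; rewrite dC (@leq_add _ _ 1 4).
case/orP: (near x) => x1; apply: (via _ x1); case/orP: (near y) => y1;
  apply: near2 y1 _ => //; by rewrite dC.
Qed.

(** * Recognizing the disconnected cases *)

(** Allows the one-vertex component as the star without leaves, and has the
    shape of the edge relation of [star], with u for the centre [None]. *)
Definition star_with_centre (C : {set T}) (u : T) : Prop :=
  u \in C /\ {in C &, forall x y, e x y = (x == u) (+) (y == u)}.

Lemma star_isoP (C : {set T}) :
  (exists u, star_with_centre C u) <->
  graph_iso (induced e (A := C)) (@edgeless 'I_1) \/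
  exists2 m, 1 <= m & graph_iso (induced e (A := C)) (star m).
Proof.
have valC (x : {x | x \in C}) : val x \in C := valP x.
split=> [[u [uC eC]]|]; last first.
  case=> [|[m _]] [f [g fK gK] fE].
    exists (val (g ord0)); split; first exact: valC.
    have all_c x (xC : x \in C) : x = val (g ord0).
      by rewrite -[x]/(val (exist _ x xC)) -[exist _ x xC]fK (ord1 (f _)).
    by move=> x y /all_c-> /all_c->; rewrite e_irr addbb.
  exists (val (g None)); split; first exact: valC.
  have cE x (xC : x \in C) : (x == val (g None)) = (f (exist _ x xC) == None).
    rewrite -[x in LHS]/(val (exist _ x xC)) val_eqE.
    by rewrite -(can_eq gK) fK.
  move=> x y xC yC; rewrite !cE.
  by rewrite -[RHS]/(star m (f (exist _ x xC)) (f (exist _ y yC))) fE.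
have card_C : #|{: {x | x \in C}}| = #|C :\ u|.+1 by rewrite card_sig (cardsD1 u C) uC.
have [C0|C_gt0] := posnP #|C :\ u|; [left|right].
  exists (fun=> ord0); last first.
    move=> x y; rewrite /induced eC ?valC //.
    have all_u z : z \in C -> z == u.
      move=> zC; apply: contraT => zu; have := card0_eq C0 z.
      by rewrite !inE zu zC.
    by rewrite !all_u ?valC.
  apply: inj_card_bij; last by rewrite card_ord card_C.
  have /fintype_le1P le1 : #|{: {x | x \in C}}| <= 1 by rewrite card_C C0.
  by move=> x y _; rewrite (le1 y x).
exists #|C :\ u| => //.
(* The centre is not listed by the enumeration of the leaves, so the search
   returns None exactly there. *)
pose f (x : {x | x \in C}) : option 'I_#|C :\ u| := [pick i | enum_val i == val x].
have fE x : (f x == None) = (val x == u).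
  rewrite /f; case: pickP => [i /eqP ix|none]; apply/esym.
    by have := enum_valP i; rewrite ix !inE => /andP[/negPf].
  apply: contraT => xu; have xC : val x \in C :\ u by rewrite !inE xu valC.
  by have := none (enum_rank_in xC (val x)); rewrite enum_rankK_in ?eqxx.
exists f; last by move=> x y; rewrite /star !fE /induced eC ?valC.
apply: inj_card_bij; last by rewrite card_option card_ord card_C.
move=> x y fxy; apply: val_inj; have := fE y; rewrite -fxy fE.
case: eqP => [-> /esym/eqP-> //|xu _].
have: f x != None by rewrite fE; apply/eqP.
move: (fxy); rewrite /f; case: pickP => // i /eqP<-; case: pickP => // j /eqP<-.
by move=> [->].
Qed.

Lemma edgeless_isoP n :
  graph_iso e (@edgeless 'I_n) <-> #|T| = n /\ forall x y, ~~ e x y.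
Proof.
split=> [[f fbij fE]|[Tn no_e]].
  by split=> [|x y]; [rewrite (bij_eq_card fbij) card_ord|rewrite -fE].
exists (fun x => cast_ord Tn (enum_rank x)); last by move=> x y; rewrite (negPf (no_e x y)).
apply: inj_card_bij; last by rewrite card_ord Tn.
by move=> x y /cast_ord_inj/enum_rank_inj.
Qed.

Lemma two_rooted_component u v :
  two_rooted u v -> ~~ connect e u v ->
  star_with_centre [set x | connect e u x] u.
Proof.
case=> dom _ indep uv; split=> [|x y]; first by rewrite inE connect0.
rewrite !inE.
have nbr z : connect e u z -> z != u -> z \notin [set u; v] /\ e u z.
  move=> uz zu; have zS : z \notin [set u; v].
    by rewrite !inE negb_or zu; apply: contraNneq uv => <-.
  split=> //; have := dom z zS; rewrite !inE => /orP[//|vz].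
  by case/negP: uv; apply: connect_trans uz (connect1 _); rewrite e_sym.
case: (altP (x =P u)) => [->|xu] ux; case: (altP (y =P u)) => [->|yu] uy.
- by rewrite e_irr.
- by case: (nbr y uy yu).
- by rewrite e_sym; case: (nbr x ux xu).
have [xS ex] := nbr x ux xu; have [yS ey] := nbr y uy yu.
by apply: negbTE; apply: indep => //; left; rewrite !inE.
Qed.

Lemma two_rooted_disconnected :
  ~~ connected_graph e ->
  (exists u v, u != v /\ two_rooted u v) <->
  #|components e [set: T]| = 2 /\
  forall C, C \in components e [set: T] -> exists u, star_with_centre C u.
Proof.
have cC : connect_sym e := sym_connect_sym e_sym.
move=> disc; split=> [[u [v [uv tr]]]|[two stars]].
  have near x : connect e u x || connect e v x.
    case: (tr) => dom _ _; case: (boolP (x \in [set u; v])) => [/set2P[]->|/dom].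
    - by rewrite connect0.
    - by rewrite connect0 orbT.
    by rewrite !inE => /orP[] /connect1->; rewrite ?orbT.
  have nc : ~~ connect e u v.
    apply: contra disc => cuv; apply/connectedP; split; first by apply/card_gt0P; exists u.
    have ux x : connect e u x by case/orP: (near x) => // /(connect_trans cuv).
    by move=> x y; apply: connect_trans (ux y); rewrite cC.
  have CE : components e [set: T] = [set [set x | connect e u x]; [set x | connect e v x]].
    apply/setP=> C; apply/components_setTP/set2P=> [[x ->]|[->|->]]; last 2 first.
    - by exists u.
    - by exists v.
    case/orP: (near x) => ux; [left|right]; apply/setP=> y; rewrite !inE;
      by rewrite (same_connect cC ux).
  split=> [|C].
    rewrite CE cards2; case: eqP => // /setP/(_ v); rewrite !inE connect0.
    by rewrite (negPf nc).
  rewrite CE => /set2P[]->; [exists u|exists v].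
    exact: two_rooted_component tr nc.
  by apply: two_rooted_component (two_rootedC tr) _; rewrite cC.
have /eqP/cards2P[A [B [AB CE]]] := two.
have in_comp C x : C \in components e [set: T] -> x \in C -> C = [set y | connect e x y].
  case/components_setTP=> z -> zx; apply/setP=> y; rewrite !inE in zx *.
  by rewrite (same_connect cC zx).
have AC : A \in components e [set: T] by rewrite CE set21.
have BC : B \in components e [set: T] by rewrite CE set22.
have [u [uA eA]] := stars A AC; have [v [vB eB]] := stars B BC.
have uv : u != v.
  apply: contraNneq AB => uv; rewrite (in_comp A u) // [X in _ == X](in_comp B v) //.
  by rewrite uv.
have cover x : x \in A \/ x \in B.
  have: [set y | connect e x y] \in components e [set: T].
    by apply/components_setTP; exists x.
  by rewrite CE => /set2P[] <-; [left|right]; rewrite inE connect0.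
have nbh_in C x y : C \in components e [set: T] -> x \in C -> e x y -> y \in C.
  by move=> CC xC xy; rewrite (in_comp C x CC xC) inE connect1.
exists u, v; split=> //.
have leaf_nbh w y : w \notin [set u; v] -> e w y -> y \in [set u; v].
  rewrite !inE negb_or => /andP[/negPf wu /negPf wv] wy.
  case: (cover w) => wC.
    by have := wy; rewrite (eA w y wC (nbh_in A w y AC wC wy)) wu /= => ->.
  have := wy; rewrite (eB w y wC (nbh_in B w y BC wC wy)) wv /= => ->.
  by rewrite orbT.
split=> [w|w wS|w1 w2 w1S w2S _].
- rewrite !inE negb_or => /andP[/negPf wu /negPf wv].
  case: (cover w) => wC; first by rewrite (eA u w uA wC) eqxx wu.
  by rewrite (eB v w vB wC) eqxx wv orbT.
- have: #|nbh e w| <= #|[set u; v]|.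
    by apply: subset_leq_card; apply/subsetP=> y; rewrite inE; apply: leaf_nbh.
  by rewrite cards2 uv.
by apply: contra w2S; apply: leaf_nbh.
Qed.

Lemma component_lt_card (C : {set T}) :
  ~~ connected_graph e -> C \in components e [set: T] -> #|C| < #|T|.
Proof.
move=> disc /components_setTP[x ->]; rewrite -cardsT proper_card // properT.
apply: contra disc => /eqP CT; apply/connectedP; split; first by apply/card_gt0P; exists x.
have cx y : connect e x y by have := in_setT y; rewrite -CT inE.
move=> y z; apply: connect_trans (cx z).
by rewrite (sym_connect_sym e_sym).
Qed.

(** Pigeonhole: the components cover the graph. *)
Lemma large_component :
  #|components e [set: T]| < #|T| ->
  exists2 C, C \in components e [set: T] & 1 < #|C|.
Proof.
move=> lt; apply/exists_inP; apply: contraLR lt; rewrite negb_exists_in => /forall_inP small.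
have coverT : cover (components e [set: T]) = setT.
  apply/setP=> x; rewrite inE; apply/bigcupP; exists [set y | connect e x y].
    by apply/components_setTP; exists x.
  by rewrite inE connect0.
have [le_cover _] := leq_card_cover (components e [set: T]).
rewrite coverT cardsT in le_cover; rewrite -leqNgt; apply: leq_trans le_cover _.
by rewrite -[leqRHS]sum1_card; apply: leq_sum => C /small; rewrite -leqNgt.
Qed.

Lemma connected_edge : connected_graph e -> 1 < #|T| -> exists x y, e x y.
Proof.
case/connectedP=> _ con /card_gt1P[x [y [_ _ xy]]].
case: (pickP (e x)) => [z xz|none]; first by exists x, z.
case/negP: xy; rewrite eq_sym.
apply: (connect_ind (P := pred1 x) _ (con x y)); last exact: eqxx.
by move=> a b ab /eqP E; rewrite E none in ab.
Qed.

(** * Small throttling numbers *)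

Lemma has_cycle_dec : has_cycle e \/ ~ has_cycle e.
Proof.
suff P : reflect (has_cycle e)
    [exists n : 'I_#|T|.+1, exists p : n.-tuple T, [&& cycle e p, uniq p & 2 < n]].
  by case: P => h; [left|right].
apply: (iffP existsP) => [[n /existsP[p /and3P[cyc U n2]]]|[c [/andP[cyc U] c2]]].
  by exists p; rewrite size_tuple /ucycle cyc U.
have le : size c < #|T|.+1 by rewrite ltnS -(card_uniqP U) max_card.
by exists (Ordinal le); apply/existsP; exists (in_tuple c); rewrite cyc U.
Qed.

Lemma blue_nonempty (S : {set T}) t :
  0 < #|T| -> psd_all_blue e S t -> 0 < #|S|.
Proof.
case/card_gt0P=> x _ /eqP blue; have: x \in iter t (psd_step e) S by rewrite blue.
by case/blue_walk=> s sS _; apply/card_gt0P; exists s.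
Qed.

Lemma throttling_le2P :
  psd_throttling e <= 2 <-> #|T| <= 2 \/ exists c, psd_all_blue e [set c] 1.
Proof.
split=> [/throttling_leP[S S2 blue]|[T2|[c blue]]]; last 2 first.
- apply/throttling_leP; exists setT; rewrite ?cardsT //.
  by apply: (@psd_all_blue_le _ 0) => //; rewrite psd_all_blue0.
- by apply/throttling_leP; exists [set c]; rewrite cards1.
have [->|T_gt0] := posnP #|T|; first by left.
have := blue_nonempty T_gt0 blue.
move: S2 blue; rewrite leq_eqVlt ltnS leq_eqVlt ltnS leqn0.
case/or3P=> [/eqP E|/cards1P[c ->]|/eqP->//] blue _.
  by left; rewrite E subnn psd_all_blue0 in blue; rewrite -cardsT -(eqP blue) E.
by right; exists c; rewrite cards1 in blue.
Qed.

Lemma throttling_le3P :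
  psd_throttling e <= 3 <->
  [\/ #|T| <= 3, exists c, psd_all_blue e [set c] 2
    | exists u v, u != v /\ psd_all_blue e [set u; v] 1].
Proof.
split=> [/throttling_leP[S S3 blue]|[T3|[c blue]|[u [v [uv blue]]]]]; last 3 first.
- apply/throttling_leP; exists setT; rewrite ?cardsT //.
  by apply: (@psd_all_blue_le _ 0) => //; rewrite psd_all_blue0.
- by apply/throttling_leP; exists [set c]; rewrite cards1.
- by apply/throttling_leP; exists [set u; v]; rewrite cards2 uv.
have [->|T_gt0] := posnP #|T|; first exact: Or31.
have := blue_nonempty T_gt0 blue; move: S3 blue.
case E: #|S| => [|[|[|[|k]]]] // _ blue _; last 1 first.
- by apply: Or31; rewrite -cardsT -(eqP blue) E.
- by have /eqP/cards1P[c Sc] := E; apply: Or32; exists c; rewrite -Sc.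
by have /eqP/cards2P[u [v [uv Suv]]] := E; apply: Or33; exists u, v; rewrite -Suv.
Qed.

(** With a and the third vertex blue, b is the only white vertex, so a forces it. *)
Lemma edge_on_three a b :
  #|T| = 3 -> e a b -> exists u v, u != v /\ psd_all_blue e [set u; v] 1.
Proof.
move=> T3 ab.
have ne : a != b by apply: contraTneq ab => ->; rewrite e_irr.
have /eqP/cards1P[z zE] : #|~: [set a; b]| = 1.
  by apply/eqP; rewrite -(eqn_add2l #|[set a; b]|) cardsC T3 cards2 ne.
have : z \in ~: [set a; b] by rewrite zE set11.
rewrite !inE negb_or => /andP[za zb].
exists a, z; split; first by rewrite eq_sym.
have white_b x : x \notin [set a; z] -> x = b.
  rewrite !inE negb_or => /andP[xa xz]; apply/eqP; apply: contraR xz => xb.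
  by rewrite -in_set1 -zE !inE negb_or xa.
apply/psd_all_blue1=> w wS.
exists a; apply/psd_forcesP; split=> //; first exact: set21.
  by rewrite (white_b w wS).
by move=> x xS _ _; rewrite (white_b w wS) (white_b x xS).
Qed.

(** Three blue vertices on a graph with an edge are traded for two blue vertices
    and one step, which leaves three kinds of graphs. *)
Lemma throttling_eq3P :
  psd_throttling e = 3 <->
  [/\ 2 < #|T|, ~ (is_tree e /\ diameter e <= 2)
    & [\/ #|T| = 3 /\ forall x y, ~~ e x y, is_tree e /\ diameter e <= 4
        | exists u v, u != v /\ two_rooted u v]].
Proof.
have tr u v : psd_all_blue e [set u; v] 1 <-> two_rooted u v := two_rootedP u v.
split=> [th3|[T3 not2 h]].
  have T3 : 2 < #|T|.
    rewrite ltnNge; apply/negP=> le.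
    by have := throttling_le2P.2 (or_introl le); rewrite th3.
  have not2 : ~ (is_tree e /\ diameter e <= 2).
    by move/(single_treeP 1).2=> h; have := throttling_le2P.2 (or_intror h); rewrite th3.
  split=> //; have : psd_throttling e <= 3 by rewrite th3.
  have pair : (exists u v, u != v /\ psd_all_blue e [set u; v] 1) ->
      exists u v, u != v /\ two_rooted u v.
    by case=> u [v [uv /tr h]]; exists u, v.
  case/throttling_le3P=> [le3|/(single_treeP 2).1 h|/pair h].
  - have TE : #|T| = 3 by apply/eqP; rewrite eqn_leq le3 T3.
    case: (boolP [exists x, exists y, e x y]) => [/existsP[x /existsP[y xy]]|].
      by apply: Or33; apply/pair/(edge_on_three TE xy).
    rewrite negb_exists => /forallP none; apply: Or31; split=> // x y.
    by have := none x; rewrite negb_exists => /forallP.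
  - exact: Or32.
  - exact: Or33.
apply/eqP; rewrite eqn_leq; apply/andP; split.
  apply/throttling_le3P; case: h => [[-> _]|/(single_treeP 2).2 h|[u [v [uv /tr h]]]].
  - exact: Or31.
  - exact: Or32.
  - by apply: Or33; exists u, v.
rewrite ltnNge; apply/negP=> /throttling_le2P[|/(single_treeP 1).1 //].
by rewrite leqNgt T3.
Qed.

End PsdThrottling.

Theorem theorem5p4 (T : finType) (e : rel T)
    (e_sym : symmetric e) (e_irr : irreflexive e) :
  psd_throttling e = 3 <->
  [\/ ~~ connected_graph e /\
      (graph_iso e (@edgeless 'I_3) \/
       [/\ #|components e [set: T]| = 2,
           forall C, C \in components e [set: T] ->
             graph_iso (induced e (A := C)) (@edgeless 'I_1) \/
             exists2 m, 1 <= m & graph_iso (induced e (A := C)) (star m)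
         & exists2 C, C \in components e [set: T] & 1 < #|C|]),
      is_tree e /\ (diameter e = 3 \/ diameter e = 4)
    | connected_graph e /\
      exists v u : T,
        [/\ v != u,
            has_cycle e \/ (is_tree e /\ diameter e = 5),
            forall w, w \notin [set u; v] -> w \in nbh e u :|: nbh e v,
            forall w, w \notin [set v; u] -> deg e w <= 2
          & forall w1 w2, w1 \notin [set u; v] -> w2 \notin [set u; v] ->
              (w1 \in nbh e u /\ w2 \in nbh e u) \/
              (w1 \in nbh e v /\ w2 \in nbh e v) ->
              ~~ e w1 w2]].
Proof.
have stars C := star_isoP e_irr C.
have th3 := throttling_eq3P e_sym e_irr.
have tree_card : is_tree e -> diameter e < #|T|.
  case=> /connectedP[T_gt0 con] _; rewrite -[#|T|](prednK T_gt0) ltnS.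
  apply: diameter_le => x y; rewrite -ltnS (prednK T_gt0); exact: dist_lt_card.
split=> [/th3[T3 not2 h]|h]; last apply/th3.
  have diam_gt2 : is_tree e -> 2 < diameter e.
    by move=> tree; rewrite ltnNge; apply/negP=> le; apply: not2.
  case: (boolP (connected_graph e)) => conn; last first.
    apply: Or31; split=> //; case: h => [h|[[]]|].
    - by left; apply/edgeless_isoP.
    - by rewrite (negPf conn).
    case/(two_rooted_disconnected e_sym e_irr conn) => two st; right.
    by split=> // [C CC|]; [apply/stars/st|apply: large_component; rewrite ?two].
  case: h => [[_ no_e]|[tree le4]|[u [v [uv tr]]]].
  - by have := connected_edge conn (ltnW T3); case=> x [y]; rewrite (negPf (no_e x y)).
  - apply: Or32; split=> //; move: (diam_gt2 tree) le4.
    by case: (diameter e) => [|[|[|[|[|]]]]] //; [left|right].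
  have vu : v != u by rewrite eq_sym.
  have diam_le5 := two_rooted_diameter e_sym conn tr.
  case: tr => dom deg2 indep.
  have {}deg2 w : w \notin [set v; u] -> deg e w <= 2 by rewrite setUC; apply: deg2.
  case: (has_cycle_dec e) => [cyc|acyc].
    by apply: Or33; split=> //; exists v, u; split=> //; left.
  have tree : is_tree e by [].
  case: (ltngtP (diameter e) 5) diam_le5 => // [lt5|d5] _; last first.
    by apply: Or33; split=> //; exists v, u; split=> //; right.
  apply: Or32; split=> //; move: (diam_gt2 tree) lt5.
  by case: (diameter e) => [|[|[|[|[|]]]]] //; [left|right].
case: h => [[disc [/edgeless_isoP[T3 no_e]|[two st [C CC C2]]]]|[tree d34]|].
- split; first by rewrite T3.
    by case=> -[]; rewrite (negPf disc).
  exact: Or31.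
- split; first exact: leq_ltn_trans C2 (component_lt_card e_sym disc CC).
    by case=> -[]; rewrite (negPf disc).
  by apply/Or33/(two_rooted_disconnected e_sym e_irr disc); split=> // D /st/stars.
- split; first by apply: ltn_trans (tree_card tree); case: d34 => ->.
    by case=> _; case: d34 => ->.
  by apply: Or32; split=> //; case: d34 => ->.
case=> conn [v [u [vu cyc_or_tree dom deg2 indep]]]; split.
- case: cyc_or_tree => [[c [/andP[_ Uc] c2]]|[tree d5]]; last first.
    by apply: ltn_trans (tree_card tree); rewrite d5.
  by apply: leq_trans c2 _; rewrite -(card_uniqP Uc) max_card.
- by case=> -[_ acyc]; case: cyc_or_tree => [/acyc|[_ ->]].
apply: Or33; exists u, v; split; first by rewrite eq_sym.
by split=> // w; rewrite setUC; apply: deg2.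
Qed.
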